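(* Let $S$ be a commutative antiring and let $n\ge 1$. Suppose that there is a maximal length of an orthogonal decomposition of $1$ in $S$, and denote it by $k$. Then the group $GL_n(S)$ of invertible $n\times n$ matrices over $S$ is isomorphic to a semidirect product $U(S)^n\rtimes (S_n)^k$ (for some action of $(S_n)^k$ on $U(S)^n$ by group automorphisms).
   Context: A semiring is a set $S$ with operations $+$ and $\cdot$ such that $(S,+)$ is a commutative monoid with identity $0$, $(S,\cdot)$ is a monoid with identity $1$, multiplication distributes over addition, and $0$ annihilates $S$. It is commutative if $ab=ba$ for all $a,b\in S$. An antiring is a semiring that is zerosumfree: $a+b=0$ implies $a=b=0$. $U(S)$ is the group of multiplicatively invertible elements of $S$, and $S_n$ is the symmetric group on $n$ letters. A set $\{a_1,\dots,a_r\}\subseteq S$ of nonzero elements is called an orthogonal decomposition of $1$ of length $r$ in $S$ if $a_1+a_2+\dots+a_r=1$ and $a_ia_j=0$ for all $i\ne j$. *)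

(* Defs.v *)
From HB Require Import structures.
From mathcomp Require Import all_boot all_order all_fingroup all_algebra.

Set Implicit Arguments.
Unset Strict Implicit.
Unset Printing Implicit Defensive.

Import GRing.Theory.

Local Open Scope ring_scope.

(* A [pzSemiRingType] is a possibly trivial (0 = 1 allowed), possibly           *)
(* non-commutative semiring with absorbing 0.                                  *)
Definition zerosumfree (S : pzSemiRingType) : Prop :=
  forall a b : S, a + b = 0 -> a = 0 /\ b = 0.

Definition orthogonal_decomposition (S : pzSemiRingType) (r : nat)
    (a : 'I_r -> S) : Prop :=
  [/\ forall i, a i != 0,
      \sum_(i < r) a i = 1
    & forall i j, i != j -> a i * a j = 0].

(* Hence indexing by 'I_r counts the elements of the set {a_1, ..., a_r}.      *)
Lemma orthogonal_decomposition_inj (S : pzSemiRingType) (r : nat)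
    (a : 'I_r -> S) : orthogonal_decomposition a -> injective a.
Proof.
move=> [nz sum1 orth] i j eq_ij; apply/eqP/negPn/negP => neq_ij.
have := nz i; rewrite -[a i]mulr1 -sum1 mulr_sumr big1 ?eqxx // => l _.
by have [<-|/orth //] := eqVneq i l; rewrite {2}eq_ij orth.
Qed.

(* Length 0 is possible only when 0 = 1, as the empty sum.                     *)
Definition max_orthogonal_length (S : pzSemiRingType) (k : nat) : Prop :=
  (exists a : 'I_k -> S, orthogonal_decomposition a) /\
  (forall (r : nat) (a : 'I_r -> S), orthogonal_decomposition a -> (r <= k)%N).

(* The library has groups of units only for rings. Over a semiring an          *)
(* invertible element is stored together with its (unique) two-sided inverse.  *)
Record units (R : pzSemiRingType) := Units {
  units_pair : R * R;
  units_pairP : (units_pair.1 * units_pair.2 == 1) &&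
                (units_pair.2 * units_pair.1 == 1)
}.

HB.instance Definition _ (R : pzSemiRingType) :=
  [isSub for @units_pair R].
HB.instance Definition _ (R : pzSemiRingType) := [Choice of units R by <:].

Definition unit_val (R : pzSemiRingType) (u : units R) : R := (units_pair u).1.

Section UnitsGroup.
Variable R : pzSemiRingType.
Implicit Types u v : units R.

Lemma unit_val_inj : injective (@unit_val R).
Proof.
move=> u v; rewrite /unit_val => eq_x; apply: val_inj => /=.
case/andP: (units_pairP u) (units_pairP v) => _ /eqP yx /andP[/eqP xy' _].
move: eq_x yx xy'; case: (units_pair u) (units_pair v) => [x y] [x' y'] /= <-.
by move=> yx xy'; rewrite -[y]mulr1 -xy' mulrA yx mul1r.
Qed.

Lemma unit_valP (x : R) :
  (exists u, unit_val u = x) <-> (exists y, x * y = 1 /\ y * x = 1).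
Proof.
split=> [[u <-]|[y [xy yx]]].
  by exists (units_pair u).2; case/andP: (units_pairP u) => /eqP ? /eqP.
have xyP : ((x, y).1 * (x, y).2 == 1) && ((x, y).2 * (x, y).1 == 1).
  by rewrite /= xy yx eqxx.
by exists (Units xyP).
Qed.

Fact units_one_subproof : ((1 : R) * 1 == 1) && ((1 : R) * 1 == 1).
Proof. by rewrite mulr1 eqxx. Qed.
Definition units_one : units R := @Units R (1, 1) units_one_subproof.

Fact units_inv_subproof u :
  ((units_pair u).2 * (units_pair u).1 == 1) &&
  ((units_pair u).1 * (units_pair u).2 == 1).
Proof. by rewrite andbC; exact: units_pairP. Qed.
Definition units_inv u : units R :=
  @Units R ((units_pair u).2, (units_pair u).1) (units_inv_subproof u).

Fact units_mul_subproof u v :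
  ((units_pair u).1 * (units_pair v).1 *
     ((units_pair v).2 * (units_pair u).2) == 1) &&
  ((units_pair v).2 * (units_pair u).2 *
     ((units_pair u).1 * (units_pair v).1) == 1).
Proof.
case/andP: (units_pairP u) (units_pairP v) => /eqP xy /eqP yx /andP[/eqP zt /eqP tz].
rewrite mulrA -(mulrA _ (units_pair v).1) zt mulr1 xy eqxx /=.
by rewrite mulrA -(mulrA _ (units_pair u).2) yx mulr1 tz.
Qed.
Definition units_mul u v : units R :=
  @Units R ((units_pair u).1 * (units_pair v).1,
            (units_pair v).2 * (units_pair u).2) (units_mul_subproof u v).

Fact units_mulA : associative units_mul.
Proof. by move=> u v w; apply: unit_val_inj; rewrite /unit_val /= mulrA. Qed.
Fact units_mul1 : left_id units_one units_mul.
Proof. by move=> u; apply: unit_val_inj; rewrite /unit_val /= mul1r. Qed.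
Fact units_mulr1 : right_id units_one units_mul.
Proof. by move=> u; apply: unit_val_inj; rewrite /unit_val /= mulr1. Qed.
Fact units_mulV : left_inverse units_one units_inv units_mul.
Proof.
move=> u; apply: unit_val_inj; rewrite /unit_val /=.
by case/andP: (units_pairP u) => _ /eqP.
Qed.
Fact units_mulrV : right_inverse units_one units_inv units_mul.
Proof.
move=> u; apply: unit_val_inj; rewrite /unit_val /=.
by case/andP: (units_pairP u) => /eqP.
Qed.

HB.instance Definition _ := isGroup.Build (units R)
  units_mulA units_mul1 units_mulr1 units_mulV units_mulrV.

End UnitsGroup.

Definition GL (n : nat) (S : pzSemiRingType) : groupType := units 'M[S]_n.

(* A left action of H on N by group endomorphisms; the two functoriality       *)
(* fields force each [autom_act h] to be an automorphism, with inverse           *)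
(* [autom_act h^-1].                                                             *)
Record autom_action (H N : groupType) := AutomAction {
  autom_act :> H -> N -> N;
  autom_actM : forall h x y, autom_act h (x * y)%g = (autom_act h x * autom_act h y)%g;
  autom_act_id : forall x, autom_act 1%g x = x;
  autom_act_comp : forall h h' x, autom_act (h * h')%g x = autom_act h (autom_act h' x)
}.

(* A wrapper around N * H, so that it does not inherit the direct product      *)
(* structure.                                                                  *)
Record semidirect (N H : groupType) (phi : autom_action H N) :=
  Semidirect { sd_pair : N * H }.

HB.instance Definition _ (N H : groupType) (phi : autom_action H N) :=
  [isNew for @sd_pair N H phi].
HB.instance Definition _ (N H : groupType) (phi : autom_action H N) :=
  [Choice of semidirect phi by <:].

Section SemidirectGroup.
Local Open Scope group_scope.
Variables (N H : groupType) (phi : autom_action H N).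
Implicit Types x y : semidirect phi.

Definition sd_one : semidirect phi := Semidirect phi (1, 1).
Definition sd_mul x y : semidirect phi :=
  Semidirect phi ((sd_pair x).1 * phi (sd_pair x).2 (sd_pair y).1,
                  (sd_pair x).2 * (sd_pair y).2).
Definition sd_inv x : semidirect phi :=
  Semidirect phi (phi (sd_pair x).2^-1 (sd_pair x).1^-1, (sd_pair x).2^-1).

Fact autom_act1 h : phi h 1 = 1.
Proof. by apply: (mulgI (phi h 1)); rewrite -autom_actM !mulg1. Qed.

Fact sd_mulA : associative sd_mul.
Proof.
move=> [[a g]] [[b h]] [[c l]]; rewrite /sd_mul /=.
by rewrite autom_actM autom_act_comp !mulgA.
Qed.
Fact sd_mul1 : left_id sd_one sd_mul.
Proof. by move=> [[a g]]; rewrite /sd_mul /= autom_act_id !mul1g. Qed.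
Fact sd_mulr1 : right_id sd_one sd_mul.
Proof. by move=> [[a g]]; rewrite /sd_mul /= autom_act1 !mulg1. Qed.
Fact sd_mulV : left_inverse sd_one sd_inv sd_mul.
Proof.
by move=> [[a g]]; rewrite /sd_mul /= -autom_actM !mulVg autom_act1.
Qed.
Fact sd_mulrV : right_inverse sd_one sd_inv sd_mul.
Proof.
by move=> [[a g]]; rewrite /sd_mul /= -autom_act_comp !mulgV autom_act_id mulgV.
Qed.

HB.instance Definition _ := isGroup.Build (semidirect phi)
  sd_mulA sd_mul1 sd_mulr1 sd_mulV sd_mulrV.

End SemidirectGroup.

Definition isomorphic (G H : groupType) : Prop :=
  exists f : G -> H, {morph f : x y / (x * y)%g} /\ bijective f.

(* Main.v *)
(* Fix an orthogonal decomposition 1 = a_1 + ... + a_k of maximal length, so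
   that S is the product of the S a_t, and an identity may be checked after
   multiplication by each a_t. If B is the inverse of A, zerosumfreeness of
   the off-diagonal entries of A B = B A = 1 makes the elements A_ij B_ji
   orthogonal, with sum 1, along each row and each column. By maximality of k,
   each a_t lies under exactly one of them in each row, in a column s_t(i);
   orthogonality along columns makes s_t a permutation. Hence
   A_ij = u_i \sum_t a_t [s_t(i) = j], where the row sum u_i = \sum_j A_ij is
   a unit with inverse \sum_j B_ji. *)
Require Import Defs.
From mathcomp Require Import all_boot all_order all_fingroup all_algebra.

Set Implicit Arguments.
Unset Strict Implicit.
Unset Printing Implicit Defensive.

Import GRing.Theory.

Local Open Scope ring_scope.

(** * Zerosumfree sums and units *)

Lemma zerosumfree_sum (S : pzSemiRingType) (I : finType) (F : I -> S) :
  zerosumfree S -> \sum_i F i = 0 -> forall i, F i = 0.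
Proof. by move=> hS + i; rewrite (bigD1 i) //= => /hS[]. Qed.

Lemma units_pair_mulr (R : pzSemiRingType) (u : units R) :
  (units_pair u).1 * (units_pair u).2 = 1.
Proof. by case/andP: (units_pairP u) => /eqP. Qed.

Lemma units_pair_mull (R : pzSemiRingType) (u : units R) :
  (units_pair u).2 * (units_pair u).1 = 1.
Proof. by case/andP: (units_pairP u) => _ /eqP. Qed.

Lemma unit_valM (R : pzSemiRingType) :
  {morph @unit_val R : u v / (u * v)%g >-> u * v}.
Proof. by []. Qed.

Section UnitsLift.
Variables (G : groupType) (R : pzSemiRingType) (f : G -> R).
Hypotheses (f1 : f 1%g = 1) (fM : {morph f : x y / (x * y)%g >-> x * y}).

Fact units_lift_subproof x : (f x * f x^-1%g == 1) && (f x^-1%g * f x == 1).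
Proof. by rewrite -!fM mulgV mulVg f1 eqxx. Qed.

(** Serves twice: to glue units of [S], and to view monomial matrices as elements of [GL n S]. *)
Definition units_lift x : units R :=
  @Units R (f x, f x^-1%g) (units_lift_subproof x).

Lemma units_liftM : {morph units_lift : x y / (x * y)%g}.
Proof. by move=> x y; apply: unit_val_inj; apply: fM. Qed.

End UnitsLift.

(** * Entries of a matrix and of its inverse over an antiring *)

Section InvertibleMatrices.
Variables (S : comPzSemiRingType) (n : nat) (A B : 'M[S]_n).
Hypotheses (hS : zerosumfree S) (AB1 : A * B = 1) (BA1 : B * A = 1).

Lemma inverse_mx_orthr i j l : i != l -> A i j * B j l = 0.
Proof.
move=> il; apply: (zerosumfree_sum (F := fun j => A i j * B j l) hS).
by move/matrixP/(_ i l): AB1; rewrite !mxE (negbTE il).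
Qed.

Lemma inverse_mx_orthl i j l : i != l -> A j l * B i j = 0.
Proof.
move=> il; rewrite mulrC.
apply: (zerosumfree_sum (F := fun j => B i j * A j l) hS).
by move/matrixP/(_ i l): BA1; rewrite !mxE (negbTE il).
Qed.

Definition entry_idem i j := A i j * B j i.

Lemma entry_idem_row i : \sum_j entry_idem i j = 1.
Proof. by move/matrixP/(_ i i): AB1; rewrite !mxE eqxx. Qed.

(** The product regroups so as to contain [A i l * B j i], a term of the off-diagonal entry (j, l)
    of BA. *)
Lemma entry_idem_row_orth i j l :
  j != l -> entry_idem i j * entry_idem i l = 0.
Proof.
move=> jl; rewrite mulrC /entry_idem [A i j * _]mulrC mulrACA.
by rewrite inverse_mx_orthl ?mul0r.
Qed.

Lemma entry_idem_col_orth j i l :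
  i != l -> entry_idem i j * entry_idem l j = 0.
Proof.
move=> il; rewrite /entry_idem [A l j * _]mulrC mulrACA.
by rewrite inverse_mx_orthr ?mul0r.
Qed.

(** The cross terms belong to off-diagonal entries of BA and vanish; what remains is the sum of the
    [entry_idem i j]. *)
Lemma row_sum_mul i : (\sum_j A i j) * (\sum_j B j i) = 1.
Proof.
rewrite mulr_suml -(entry_idem_row i); apply: eq_bigr => j _.
rewrite mulr_sumr (bigD1 j) //= big1 ?addr0 // => l lj.
exact: inverse_mx_orthl.
Qed.

(** Writing [A i j] as [A i j * \sum_l entry_idem i l], both sides agree termwise: for l different
    from j both terms are 0. *)
Lemma row_sum_idem i j : (\sum_l A i l) * entry_idem i j = A i j.
Proof.
rewrite -[RHS]mulr1 -(entry_idem_row i) mulr_suml mulr_sumr.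
apply: eq_bigr => l _; rewrite /entry_idem.
have [-> //|lj] := eqVneq l j.
rewrite mulrCA [A i l * B j i]inverse_mx_orthl 1?eq_sym // mulr0.
by rewrite mulrCA [A i j * B l i]inverse_mx_orthl // mulr0.
Qed.

End InvertibleMatrices.

(** * Orthogonal decompositions of maximal length *)

Section MaximalDecomposition.
Variables (S : comPzSemiRingType) (k : nat) (a : 'I_k -> S).
Hypothesis (ha : orthogonal_decomposition a).

Lemma decomp_ext x y : (forall t, a t * x = a t * y) -> x = y.
Proof.
case: ha => _ a1 _ xy; rewrite -[x]mul1r -[y]mul1r -a1 !mulr_suml.
exact: eq_bigr.
Qed.

(** The element of S whose component in each factor S a_t is that of [x t]. *)
Definition glue (x : 'I_k -> S) := \sum_t a t * x t.

Lemma decomp_glue x t : a t * glue x = a t * x t.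
Proof.
case: ha => _ a1 orth; rewrite /glue mulr_sumr (bigD1 t) //= big1 => [|l lt].
  (* Expanding [a t * 1] shows that [a t] is idempotent. *)
  rewrite addr0 mulrA -{3}[a t]mulr1 -a1.
  rewrite [a t * \sum_i _]mulr_sumr (bigD1 t) //=.
  by rewrite [X in _ + X]big1 ?addr0 // => l lt; rewrite orth // eq_sym.
by rewrite mulrA orth ?mul0r // eq_sym.
Qed.

Hypothesis maxk :
  forall r (b : 'I_r -> S), orthogonal_decomposition b -> (r <= k)%N.

(* Otherwise replacing a_t by a_t e and a_t f gives length k + 1. *)
Lemma maximal_decomp_split e f t :
  e + f = 1 -> e * f = 0 -> a t * e = 0 \/ a t * f = 0.
Proof.
case: (ha) => a0 a1 orth ef1 ef0.
have [ae0|ae0] := eqVneq (a t * e) 0; first by left.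
have [af0|af0] := eqVneq (a t * f) 0; first by right.
pose b j := if j == t then a t * e else a j.
pose c (i : 'I_k.+1) := if unlift ord0 i is Some j then b j else a t * f.
have afb j : a t * f * b j = 0.
  rewrite /b; case: eqVneq => [_|jt].
    by rewrite mulrACA [f * e]mulrC ef0 mulr0.
  by rewrite mulrAC orth ?mul0r // eq_sym.
suff /maxk : orthogonal_decomposition c by rewrite ltnn.
split=> [i||i j].
- by rewrite /c; case: unliftP => [j _|//]; rewrite /b; case: (j =P t).
- rewrite big_ord_recl /c unlift_none.
  rewrite (eq_bigr b) => [|j _]; last by rewrite liftK.
  rewrite (bigD1 t) //= {1}/b eqxx addrA -mulrDr.
  rewrite addrC [f + e]addrC ef1 mulr1 addrC.
  rewrite -a1 [RHS](bigD1 t) //=; congr (_ + _).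
  by apply: eq_bigr => j /negbTE jt; rewrite /b jt.
rewrite /c; case: (unliftP ord0 i) => [i'|] ->;
  case: (unliftP ord0 j) => [j'|] ->.
- rewrite (inj_eq lift_inj) /b => ij.
  have [it|it] := eqVneq i' t; have [jt|jt] := eqVneq j' t.
  + by rewrite it jt eqxx in ij.
  + by rewrite mulrAC orth ?mul0r // eq_sym.
  + by rewrite mulrA orth ?mul0r.
  + by rewrite orth.
- by rewrite mulrC afb.
- by rewrite afb.
- by rewrite eqxx.
Qed.

Lemma maximal_decomp_select (I : finType) (e : I -> S) t :
    \sum_i e i = 1 -> (forall i j, i != j -> e i * e j = 0) ->
  exists i, forall j, a t * e j = a t * (i == j)%:R.
Proof.
move=> e1 orth.
have /existsP[i aei0] : [exists i, a t * e i != 0].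
  rewrite -[[exists _, _]]negbK negb_exists; apply/negP => /forallP ae0.
  case: ha => /(_ t)/negP[]; rewrite -[a t]mulr1 -e1 mulr_sumr big1 // => i _.
  by move: (ae0 i); rewrite negbK => /eqP.
(* Lumping the other summands together gives a two-term splitting of 1; as [a t * e i] is nonzero,
   [a t] must kill the rest. *)
have e1' : e i + \sum_(j | j != i) e j = 1 by rewrite -e1 [RHS](bigD1 i).
have aei : a t * e i = a t.
  have [|/eqP|af0] := maximal_decomp_split t e1'; last 2 first.
  - by rewrite (negbTE aei0).
  - by rewrite -[RHS]mulr1 -e1' mulrDr af0 addr0.
  by rewrite mulr_sumr big1 // => j ji; rewrite orth // eq_sym.
exists i => j; case: eqVneq => [<-|ij]; first by rewrite mulr1.
by rewrite -aei -mulrA orth // !mulr0.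
Qed.

(** * The action of (S_n)^k on U(S)^n *)

Variable n : nat.
Local Notation units_pow := {ffun 'I_n -> units S}.
Local Notation perm_pow := {ffun 'I_k -> 'S_n}.
Implicit Types (s r : perm_pow) (u v : units_pow).

Definition glue_units (v : {ffun 'I_k -> units S}) :=
  glue (fun t => unit_val (v t)).

Lemma glue_units1 : glue_units 1%g = 1.
Proof.
by apply: decomp_ext => t; rewrite decomp_glue ffunE.
Qed.

Lemma glue_unitsM : {morph glue_units : v w / (v * w)%g >-> v * w}.
Proof.
move=> v w; apply: decomp_ext => t.
by rewrite mulrA !decomp_glue ffunE mulrAC decomp_glue mulrAC mulrA.
Qed.

(** In the factor S a_t, the coordinates are permuted by [s t]. *)
Definition perm_pow_act s v : units_pow :=
  [ffun i => units_lift glue_units1 glue_unitsM [ffun t => v (s t i)]].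

Lemma decomp_perm_pow_act s v t i :
  a t * unit_val (perm_pow_act s v i) = a t * unit_val (v (s t i)).
Proof. by rewrite ffunE decomp_glue ffunE. Qed.

Lemma units_pow_ext u v :
  (forall t i, a t * unit_val (u i) = a t * unit_val (v i)) -> u = v.
Proof.
by move=> uv; apply/ffunP => i; apply/unit_val_inj/decomp_ext => t.
Qed.

Fact perm_pow_actM s u v :
  perm_pow_act s (u * v)%g = (perm_pow_act s u * perm_pow_act s v)%g.
Proof.
apply: units_pow_ext => t i; rewrite decomp_perm_pow_act.
rewrite [(u * v)%g _]ffunE [(_ * perm_pow_act s v)%g _]ffunE !unit_valM.
rewrite mulrA [in RHS]mulrA decomp_perm_pow_act [in RHS]mulrAC.
by rewrite decomp_perm_pow_act mulrAC.
Qed.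

Fact perm_pow_act_id v : perm_pow_act 1%g v = v.
Proof.
by apply: units_pow_ext => t i; rewrite decomp_perm_pow_act ffunE perm1.
Qed.

(** Precomposition is a left action here because a product of permutations applies its left factor
    first. *)
Fact perm_pow_act_comp s r v :
  perm_pow_act (s * r)%g v = perm_pow_act s (perm_pow_act r v).
Proof.
by apply: units_pow_ext => t i; rewrite !decomp_perm_pow_act ffunE permM.
Qed.

Definition perm_pow_action : autom_action perm_pow units_pow :=
  AutomAction perm_pow_actM perm_pow_act_id perm_pow_act_comp.

(** * Monomial matrices and the isomorphism *)

Definition monomial_mx (x : semidirect perm_pow_action) : 'M[S]_n :=
  \matrix_(i, j) (unit_val ((sd_pair x).1 i) *
                  glue (fun t => ((sd_pair x).2 t i == j)%:R)).

Lemma decomp_monomial_mx x t i j :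
  a t * monomial_mx x i j =
  a t * unit_val ((sd_pair x).1 i) * ((sd_pair x).2 t i == j)%:R.
Proof. by rewrite mxE mulrCA decomp_glue mulrCA mulrA. Qed.

Lemma monomial_mx1 : monomial_mx 1%g = 1.
Proof.
apply/matrixP => i j; apply: decomp_ext => t; rewrite decomp_monomial_mx /=.
by rewrite !ffunE perm1 mulr1 mxE.
Qed.

Lemma monomial_mxM :
  {morph monomial_mx : x y / (x * y)%g >-> x * y}.
Proof.
move=> [[u s]] [[v r]]; apply/matrixP => i l; apply: decomp_ext => t.
(* In the factor S a_t, row i of the first matrix is supported on column [s t i]. *)
rewrite decomp_monomial_mx /= mxE mulr_sumr (bigD1 (s t i)) //= big1 => [|j sj].
  rewrite addr0 mulrA decomp_monomial_mx /= eqxx mulr1.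
  rewrite [in RHS]mulrAC decomp_monomial_mx /= [(s * r)%g t]ffunE permM.
  rewrite [(u * _)%g i]ffunE unit_valM mulrA (mulrAC (a t) (unit_val (u i))).
  by rewrite decomp_perm_pow_act [in RHS]mulrAC.
by rewrite mulrA decomp_monomial_mx /= eq_sym (negbTE sj) mulr0 mul0r.
Qed.

(** Row sums recover the units; if then [s t i] and [r t i] differed, [a t] times a unit would be
    0. *)
Lemma monomial_mx_inj : injective monomial_mx.
Proof.
move=> [[u s]] [[v r]] eq_mx.
have row_sum (w : units_pow) (q : perm_pow) t i :
    a t * \sum_j monomial_mx (Semidirect _ (w, q)) i j = a t * unit_val (w i).
  rewrite mulr_sumr (bigD1 (q t i)) //= big1 => [|j qj].
    by rewrite addr0 decomp_monomial_mx /= eqxx mulr1.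
  by rewrite decomp_monomial_mx /= eq_sym (negbTE qj) mulr0.
have uv : u = v.
  by apply: units_pow_ext => t i; rewrite -(row_sum u s) eq_mx row_sum.
rewrite -{}uv in eq_mx *; suff -> : s = r by [].
apply/ffunP => t; apply/permP => i; apply/eqP/negPn/negP => sr.
have [/(_ t)/negP[]] := ha.
have := decomp_monomial_mx (Semidirect _ (u, r)) t i (s t i).
rewrite -eq_mx decomp_monomial_mx /= eqxx mulr1 eq_sym (negbTE sr) mulr0 => au0.
by rewrite -[a t]mulr1 -(units_pair_mulr (u i)) mulrA au0 mul0r.
Qed.

Lemma monomial_mx_surj (A B : 'M[S]_n) :
  zerosumfree S -> A * B = 1 -> B * A = 1 -> exists x, monomial_mx x = A.
Proof.
move=> hS AB1 BA1; pose e := entry_idem A B.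
have /fin_all_exists[s sE] t : exists st : 'I_n -> 'I_n,
    forall i l, a t * e i l = a t * (st i == l)%:R.
  apply: (fin_all_exists (P := fun i j =>
    forall l, a t * e i l = a t * (j == l)%:R)) => i.
  apply: maximal_decomp_select; first exact: entry_idem_row.
  exact: entry_idem_row_orth.
(* If rows i and l selected the same column, column orthogonality would give [a t = 0]. *)
have s_inj t : injective (s t).
  move=> i l sil; apply/eqP/negPn/negP => il.
  case: ha => /(_ t)/negP[].
  have := congr1 ( *%R (a t)) (entry_idem_col_orth hS AB1 (s t i) il).
  by rewrite mulrA sE eqxx mulr1 sil sE eqxx mulr1 mulr0 => ->.
have /fin_all_exists[u uE] i : exists w : units S, unit_val w = \sum_j A i j.
  apply/unit_valP; exists (\sum_j B j i).
  by rewrite [X in _ /\ X = _]mulrC (row_sum_mul hS AB1 BA1).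
exists (Semidirect _ ([ffun i => u i], [ffun t => perm (s_inj t)])).
apply/matrixP => i j; apply: decomp_ext => t.
rewrite decomp_monomial_mx /= !ffunE permE uE.
by rewrite mulrAC -sE mulrAC -mulrA (row_sum_idem hS AB1 BA1).
Qed.

Lemma GL_semidirect_iso :
  zerosumfree S -> isomorphic (GL n S) (semidirect perm_pow_action).
Proof.
move=> hS; pose f := units_lift monomial_mx1 monomial_mxM.
have fM : {morph f : x y / (x * y)%g} := units_liftM _ _.
have f_inj : injective f.
  by move=> x y /(congr1 (@unit_val _)); apply: monomial_mx_inj.
(* The boolean form lets [xchoose] pick preimages; the isomorphism is the resulting inverse [g] of
   [f]. *)
have f_surj X : exists x, f x == X.
  have [x fx] :=
    monomial_mx_surj hS (units_pair_mulr X) (units_pair_mull X).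
  by exists x; apply/eqP/unit_val_inj.
pose g X := xchoose (f_surj X).
have fK : cancel g f by move=> X; apply/eqP/(xchooseP (f_surj X)).
exists g; split; first by move=> X Y; apply: f_inj; rewrite fM !fK.
by exists f => // x; apply: f_inj; rewrite fK.
Qed.

End MaximalDecomposition.

Theorem corollary2 (S : comPzSemiRingType) (n k : nat)
    (hS : zerosumfree S) (hn : (1 <= n)%N) (hk : max_orthogonal_length S k) :
  exists phi : autom_action {ffun 'I_k -> 'S_n} {ffun 'I_n -> units S},
    isomorphic (GL n S) (semidirect phi).
Proof.
case: hk => [[a ha] maxk]; exists (perm_pow_action ha n).
exact: GL_semidirect_iso ha maxk n hS.
Qed.
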